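(* Let $d$ and $k$ be given positive integers. Then there exist constants $A_{d,k}$ and $B_{d,k}$ such that, as $n\to\infty$, $$\mathbb{E}[X_{n,dn+1}^k]=A_{d,k}\,n^{2k}+O(n^{2k-1}),\qquad \mathbb{E}[X_{n,dn-1}^k]=B_{d,k}\,n^{2k}+O(n^{2k-1}).$$
   Context: A partition $\lambda=(\lambda_1\ge\dots\ge\lambda_\ell)$ has size $|\lambda|=\sum_i\lambda_i$. The hook length of a box of its Young diagram is the number of boxes directly to its right, directly below it, plus the box itself. For a positive integer $t$, $\lambda$ is a $t$-core if none of its hook lengths is divisible by $t$; an $(s,t)$-core is both an $s$-core and a $t$-core. For coprime $s,t$, $X_{s,t}$ denotes the size of a partition chosen uniformly at random from the finite set of $(s,t)$-core partitions with distinct parts. *)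

(* Defs.v *)
From mathcomp Require Import all_boot all_order all_algebra.
From mathcomp Require Import finmap.
From mathcomp Require Import all_classical all_reals all_analysis.

Set Implicit Arguments.
Unset Strict Implicit.
Unset Printing Implicit Defensive.

Import GRing.Theory Num.Theory.
Import numFieldNormedType.Exports.

Local Open Scope classical_set_scope.
Local Open Scope ring_scope.

Definition is_partition (la : seq nat) : bool :=
  sorted geq la && (0%N \notin la).

(* Rows and columns are numbered from 0; [(i, j)] is a box of the Young diagram
   of [la] when [j < nth 0 la i] (in particular [i < size la]). *)
Definition in_diagram (la : seq nat) (i j : nat) : bool :=
  (j < nth 0%N la i)%N.

Definition arm (la : seq nat) (i j : nat) : nat :=
  (nth 0%N la i - j.+1)%N.

Definition leg (la : seq nat) (i j : nat) : nat :=
  count (fun r => j < r)%N (drop i.+1 la).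

Definition hook_length (la : seq nat) (i j : nat) : nat :=
  (arm la i j + leg la i j + 1)%N.

Definition is_core (t : nat) (la : seq nat) : Prop :=
  forall i j : nat, in_diagram la i j -> ~~ (t %| hook_length la i j)%N.

Definition distinct_cores (s t : nat) : set (seq nat) :=
  [set la | [/\ is_partition la, uniq la, is_core s la & is_core t la]].

(* Meaningful only for [A] finite and nonempty: [fset_set A] is empty when [A]
   is infinite. *)
Definition uniform_expectation (R : realType) (T : choiceType) (A : set T)
    (f : T -> R) : R :=
  (\sum_(x \in A) f x) / (#|` fset_set A|%fset)%:R.

(* E[X_{s,t}^k]. For coprime positive [s] and [t] the set [distinct_cores s t]
   is finite, and it always contains the empty partition. *)
Definition core_size_moment (R : realType) (s t k : nat) : R :=
  uniform_expectation (distinct_cores s t) (fun la => (sumn la)%:R ^+ k).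

(* Main.v *)
(** Record a partition by the set of its first-column hook lengths. It is a
    t-core with distinct parts exactly when this set is closed under
    subtraction of t and contains no two consecutive integers. Sorting the set
    by residues mod n, the (n, dn + 1)-cores with distinct parts correspond to
    the words (a_1, ..., a_(n-1)) over {0, ..., d} without two adjacent nonzero
    letters; for (n, dn - 1)-cores one also requires a_(n-1) < d. The size of
    the core is sum (r a_r + n C(a_r, 2)) - C(sum a_r, 2).

    The number F_N of words satisfies F_(N+2) = F_(N+1) + d F_N, whose
    dominant root is lam. For centred letter statistics Z = sum w_r g(a_r), the
    same decomposition of words bounds first the sum of Z, where the drift is
    geometrically small because F_(N+1) - lam F_N = (1 - lam)^(N+2), and then
    the sum of Z^2. Hence the size equals c n^2 + Y with E[Y] = O(n),
    E[Y^2] = O(n^3) and Y = O(n^2), and a Taylor expansion to first order gives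
    E[X^k] = c^k n^(2k) + O(n^(2k-1)) in both cases. *)
Require Import Defs.
From mathcomp Require Import all_boot all_order all_algebra.
From mathcomp Require Import all_classical all_reals all_analysis.
From mathcomp Require Import zify ring lra.

Set Implicit Arguments.
Unset Strict Implicit.
Unset Printing Implicit Defensive.

(** * First-column hook lengths *)

(** The first box of a row [h > 0] with [size la'] nonempty rows below it has arm [h - 1] and leg
    [size la']. *)
Fixpoint beta (la : seq nat) : seq nat :=
  if la is h :: la' then (h + size la') :: beta la' else [::].

Fixpoint unbeta (b : seq nat) : seq nat :=
  if b is x :: b' then (x - size b') :: unbeta b' else [::].

Lemma size_beta la : size (beta la) = size la.
Proof. by elim: la => //= h la ->. Qed.

Lemma size_unbeta b : size (unbeta b) = size b.
Proof. by elim: b => //= h la ->. Qed.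

Lemma betaK : cancel beta unbeta.
Proof. by elim=> //= h la ->; rewrite size_beta addnK. Qed.

Lemma size_gtn_path x b : path gtn x b -> size b <= x.
Proof. by elim: b x => //= y b IH x /andP[xy /IH]; lia. Qed.

Lemma unbetaK b : sorted gtn b -> beta (unbeta b) = b.
Proof.
elim: b => //= x b IH pb; rewrite size_unbeta IH ?(path_sorted pb) //.
by rewrite subnK // size_gtn_path.
Qed.

Lemma sorted_beta la : sorted geq la -> sorted gtn (beta la).
Proof.
by case: la => //= h la; elim: la h => //= h' la IH h /andP[hh' /IH ->]; lia.
Qed.

Lemma beta_bound h la x :
  sorted geq (h :: la) -> x \in beta la -> x < h + size la.
Proof.
move=> /sorted_beta /= /order_path_min -/(_ (rev_trans ltn_trans)) /allP; exact.
Qed.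

Lemma sumn_beta la : sumn (beta la) = sumn la + 'C(size la, 2).
Proof.
by elim: la => //= h la ->; rewrite binS bin1; lia.
Qed.

(* [gap la j] is the j-th natural number missing from [beta la]; the hook at
   [(i, j)] has length [nth 0 (beta la) i - gap la j]. *)
Definition gap (la : seq nat) (j : nat) : nat := j + count (geq j) la.

Lemma count_geq_head h la j :
  sorted geq (h :: la) -> h <= j -> count (geq j) la = size la.
Proof.
move=> /(order_path_min (rev_trans leq_trans))/allP H hj.
by apply/eqP; rewrite -all_count; apply/allP => z /H /=; lia.
Qed.

(** Number the steps of the boundary of the diagram from 0 at the bottom left: vertical steps carry
    the entries of [beta la], horizontal steps the gaps, so no number is both. *)
Lemma gap_notin la j : sorted geq la -> gap la j \notin beta la.
Proof.
elim: la => //= h la IH hla; have := IH (path_sorted hla).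
rewrite inE negb_or /gap /=; case: (leqP h j) => hj.
  rewrite (count_geq_head hla hj) => _; apply/andP; split; first by lia.
  by apply/negP => /(beta_bound hla); lia.
by rewrite add0n => ->; have := count_size (geq j) la; lia.
Qed.

Lemma notin_gap la y :
  sorted geq la -> y \notin beta la -> exists j, y = gap la j.
Proof.
elim: la y => [|h la IH] y /= hla; first by exists y; rewrite /gap addn0.
rewrite inE negb_or => /andP[yh /(IH _ (path_sorted hla))[j yE]].
rewrite {}yE /gap in yh *; case: (leqP h j) => hj; last first.
  by exists j => /=; lia.
(* Here [y = j + size la] differs from [h + size la], so [h < j], and the new first row moves this
   gap one column to the left. *)
move: yh; rewrite (count_geq_head hla hj) => yh; exists j.-1 => /=.
by rewrite (count_geq_head hla); lia.
Qed.

Lemma is_core_cons t h la :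
  is_core t (h :: la) <->
  (forall j, j < h -> ~~ (t %| hook_length (h :: la) 0 j)) /\ is_core t la.
Proof.
split=> [H|[H1 H2] [|i] j]; [split=> [j|i j] | exact: H1 | exact: H2].
  exact: (H 0).
exact: (H i.+1).
Qed.

Lemma hook_length_row0 h la j :
  j < h -> hook_length (h :: la) 0 j = h + size la - gap (h :: la) j.
Proof.
move=> jh; rewrite /hook_length /arm /leg /gap /= drop0.
have <- := count_predC (geq j) la.
rewrite (@eq_count _ (predC (geq j)) (ltn j)); last by move=> z /=; lia.
rewrite leqNgt jh /=; set p := count _ la; set q := count _ la.
by lia.
Qed.

(** The boxes of a row pair its first-column hook with the gaps below that number, and each hook
    length is the difference. The induction removes the first row. *)
Lemma is_core_gaps t la : sorted geq la ->
  is_core t la <->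
  (forall x y, x \in beta la -> y \notin beta la -> y < x -> ~~ (t %| x - y)).
Proof.
elim: la => [|h la IH] hla; first by split => // _ i j; case: i.
have sla := path_sorted hla.
rewrite is_core_cons (IH sla); split=> [[H1 H2] x y|H]; last split.
- rewrite inE => /orP[/eqP->|xla] yla yx.
    have [j yE] := notin_gap hla yla.
    have jh : j < h.
      rewrite ltnNge; apply/negP => hj; move: yx; rewrite yE /gap /= hj.
      by rewrite (count_geq_head hla hj); lia.
    by rewrite yE -hook_length_row0 ?H1.
  by apply: H2 => //; move: yla; rewrite inE negb_or => /andP[].
- move=> j jh; rewrite hook_length_row0 //; apply: H; first by rewrite inE eqxx.
    exact: gap_notin.
  by rewrite /gap /= [h <= j]leqNgt jh /=; have := count_size (geq j) la; lia.
- move=> x y xla yla yx; apply: H => //; first by rewrite inE xla orbT.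
  rewrite inE negb_or yla andbT.
  by have := beta_bound hla xla; lia.
Qed.

(** If [x - t] were missing, [t] itself would be a hook length. Conversely, if [t] divides [x - y],
    steps of [t] lead from [x] down to [y] without leaving the set. *)
Lemma is_core_beta t la : 0 < t -> sorted geq la ->
  is_core t la <->
  (forall x, x \in beta la -> t <= x -> x - t \in beta la).
Proof.
move=> t0 sla; rewrite (is_core_gaps _ sla); split=> H x.
  move=> xla tx; apply/negPn/negP => /(H _ _ xla).
  by rewrite subKn // dvdnn => /(_ _)/negP; apply => //; lia.
move=> y xla yla yx; apply/negP => /dvdnP[q].
elim: q x xla yx => [|q IH] x xla yx E; first by lia.
have tx : t <= x by rewrite mulSn in E; lia.
have := H x xla tx; case: (ltngtP y (x - t)) => yxt xt.
- by apply: IH xt _ _ => //; rewrite mulSn in E; lia.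
- by rewrite mulSn in E; lia.
- by rewrite -yxt (negPf yla) in xt.
Qed.

(** Successive entries drop by at least two: one from the strictly decreasing parts, one from the
    number of rows below. *)
Lemma beta_no_succ la x : sorted gtn la -> x \in beta la -> x.+1 \notin beta la.
Proof.
have bound h l y : path gtn h l -> y \in beta l -> y.+1 < h + size l.
  elim: l h y => //= h' l IH h y /andP[hh' pl].
  rewrite inE => /orP[/eqP->|/(IH _ _ pl)]; lia.
elim: la x => //= h la IH x hla; rewrite !inE !negb_or.
have sla := path_sorted hla.
move=> /orP[/eqP->|xla]; apply/andP; split; first by lia.
- by apply/negP => /(bound _ _ _ hla); lia.
- by have := bound _ _ _ hla xla; lia.
- exact: IH.
Qed.

Lemma beta_neq0 la : sorted geq la -> 0 \notin la -> 0 \notin beta la.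
Proof.
move=> sla la0; have := gap_notin 0 sla; rewrite /gap add0n.
suff -> : count (geq 0) la = 0 by [].
apply/eqP; rewrite eqn0Ngt -has_count; apply/negP => /hasP[z zla] /=.
by rewrite leqn0 => /eqP z0; rewrite -z0 zla in la0.
Qed.

(** Subtracting the row counts lowers each spacing by one, so spacings of at least two leave
    distinct parts. A strictly decreasing list avoiding 0 has each entry above the number of later
    entries, so the parts are positive. *)
Lemma unbeta_distinct b : sorted gtn b -> 0 \notin b ->
  (forall x, x \in b -> x.+1 \notin b) ->
  sorted gtn (unbeta b) && (0 \notin unbeta b).
Proof.
have pos x b' : path gtn x b' -> 0 \notin x :: b' -> size b' < x.
  elim: b' x => [|y b' IH] x /=; first by rewrite inE; lia.
  by rewrite !inE !negb_or => /andP[xy /IH]; rewrite inE negb_or => H; lia.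
elim: b => //= x b IH xb nb gb.
have /andP[s1 s2] : sorted gtn (unbeta b) && (0 \notin unbeta b).
  apply: IH; first exact: path_sorted xb.
    by move: nb; rewrite inE negb_or => /andP[].
  move=> y yb; have := gb y; rewrite !inE yb orbT negb_or.
  by move=> /(_ isT)/andP[].
apply/andP; split; last first.
  by rewrite inE negb_or s2 andbT; have := pos _ _ xb nb; lia.
case: b {IH s2} xb nb gb s1 => //= y b /andP[xy yb] nb gb s1.
apply/andP; split=> //.
have := gb y; rewrite !inE eqxx orbT negb_or => /(_ isT)/andP[yx _].
have := size_gtn_path yb; lia.
Qed.

(** * Cores with distinct parts as words *)

(** A nonzero first letter forces a 0 after it, hence a recursion reaching back two lengths. Listing
    the words in this shape lets sums over them split along it. *)
Fixpoint words (d N : nat) : seq (seq nat) :=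
  match N with
  | 0 => [:: [::]]
  | N1.+1 =>
    match N1 with
    | 0 => [seq [:: j] | j <- iota 0 d.+1]
    | N2.+1 => [seq 0 :: x | x <- words d N1]
               ++ [seq j.+1 :: 0 :: x | j <- iota 0 d, x <- words d N2]
    end
  end.
Arguments words : simpl never.

Definition no_adjacent (a b : nat) : bool := (a == 0) || (b == 0).

Lemma words_rec d N : words d N.+2 = [seq 0 :: x | x <- words d N.+1]
  ++ [seq j.+1 :: 0 :: x | j <- iota 0 d, x <- words d N].
Proof. by []. Qed.

Lemma mem_words d N x :
  (x \in words d N) =
    [&& size x == N, all (geq d) x & sorted no_adjacent x].
Proof.
have cons0 N0 y : y \in [seq 0 :: z | z <- words d N0] =
    if y is a :: z then (a == 0) && (z \in words d N0) else false.
  apply/mapP/idP => [[z zw ->]|]; first by rewrite eqxx.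
  by case: y => // a z /andP[/eqP-> zw]; exists z.
elim/ltn_ind: N x => -[|[|N]] IH x.
- by rewrite /words inE; case: x.
- rewrite /words; apply/mapP/idP => [[j]|]; first by rewrite mem_iota => jd -> /=; lia.
  case: x => [|a [|b x]] //= /andP[ad _]; exists a => //.
  by rewrite inE mem_iota; lia.
rewrite words_rec mem_cat cons0.
have -> : (x \in [seq j.+1 :: 0 :: z | j <- iota 0 d, z <- words d N]) =
    if x is a.+1 :: 0 :: z then (a < d) && (z \in words d N) else false.
  apply/allpairsP/idP => [[[j z]] /= [jd zw ->]|].
    by rewrite zw andbT; move: jd; rewrite mem_iota; lia.
  case: x => [|[|a] [|[|b] z]] //= /andP[ad zw].
  by exists (a, z); split=> //=; rewrite mem_iota; lia.
case: x => [|[|a] [|[|b] z]] //=; rewrite ?IH //= ?eqSS ?orbF ?andbF //.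
rewrite andbCA; congr (_ && _); rewrite andbA; congr (_ && _); by case: z.
Qed.

Lemma size_words d N x : x \in words d N -> size x = N.
Proof. by rewrite mem_words => /and3P[/eqP]. Qed.

Lemma uniq_words d N : uniq (words d N).
Proof.
elim/ltn_ind: N => -[|[|N]] IH //.
  by rewrite /words map_inj_uniq ?iota_uniq // => i j [].
rewrite words_rec cat_uniq map_inj_uniq ?IH //=; last by move=> x y [].
rewrite allpairs_uniq ?iota_uniq ?IH //= ?andbT; last first.
  by move=> [i x] [j y] _ _ /= [-> ->].
by apply/hasPn => y /allpairsP[[j z] /= [_ _ ->]]; apply/mapP => -[].
Qed.

(** * The core attached to a word *)

Section FirstColumnHooks.
Variable n : nat.
Hypothesis n_gt0 : 0 < n.

(* The entry of a word of length [N] at position [N - r] is the number of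
   first-column hooks congruent to [r] mod [n]. *)
Fixpoint hooks_of (x : seq nat) : seq nat :=
  if x is a :: x' then
    [seq (size x').+1 + i * n | i <- iota 0 a] ++ hooks_of x'
  else [::].

(* The value at [r = 0] is the default value [0] of [nth]. *)
Definition height (x : seq nat) (r : nat) : nat := nth 0 x (size x - r).

(** Division by [n] recovers the letter from the residue and the index from the quotient;
    [size x < n] keeps the residues of different letters distinct and nonzero. *)
Lemma mem_hooks_of x y : size x < n ->
  (y \in hooks_of x) = (y %% n <= size x) && (y %/ n < height x (y %% n)).
Proof.
elim: x => [|a x IH] /= sx.
  by rewrite in_nil /height nth_nil ltn0 andbF.
rewrite mem_cat IH; last by lia.
have -> : (y \in [seq (size x).+1 + i * n | i <- iota 0 a]) =
    (y %% n == (size x).+1) && (y %/ n < a).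
  apply/mapP/idP => [[i]|/andP[/eqP yn ya]]; last first.
    by exists (y %/ n); rewrite ?mem_iota ?add0n // -yn addnC -divn_eq.
  rewrite mem_iota add0n => /andP[_ ia] ->.
  by rewrite addnC divnMDl // divn_small // modnMDl modn_small // eqxx addn0.
rewrite /height /=; case: (ltngtP (y %% n) (size x).+1) => yn.
- by rewrite -(ltnS (y %% n)) yn subSn //= -ltnS.
- by rewrite (leqNgt _ (size x)) (ltnW yn).
- by rewrite yn ltnn subnn /= orbF.
Qed.

Lemma uniq_hooks_of x : size x < n -> uniq (hooks_of x).
Proof.
elim: x => [|a x IH] //= sx; rewrite cat_uniq IH; last by lia.
rewrite map_inj_uniq ?iota_uniq /=; last first.
  by move=> i j /addnI/eqP; rewrite eqn_pmul2r // => /eqP.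
rewrite andbT; apply/hasPn => y; rewrite mem_hooks_of; last by lia.
move=> /andP[ysx _]; apply/mapP => -[i _ E]; move: ysx.
by rewrite E addnC modnMDl modn_small // ltnn.
Qed.

Lemma size_hooks_of x : size (hooks_of x) = sumn x.
Proof. by elim: x => //= a x IH; rewrite size_cat size_map size_iota IH. Qed.

Fixpoint site_sum (x : seq nat) : nat :=
  if x is a :: x' then (size x').+1 * a + site_sum x' else 0.

Lemma sumn_hooks_of x :
  sumn (hooks_of x) = site_sum x + n * sumn [seq 'C(a, 2) | a <- x].
Proof.
elim: x => [|a x IH] /=; first by rewrite muln0.
rewrite sumn_cat IH; suff -> : forall c,
    sumn [seq c + i * n | i <- iota 0 a] = c * a + n * 'C(a, 2) by lia.
move=> c; elim: a {IH} => [|a IH]; first by rewrite bin0n !muln0.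
by rewrite -addn1 iotaD map_cat sumn_cat IH /= addn1 binS bin1; lia.
Qed.

Definition core_of (x : seq nat) : seq nat := unbeta (sort geq (hooks_of x)).

Lemma sorted_hooks_of x : size x < n -> sorted gtn (sort geq (hooks_of x)).
Proof.
move=> sx; rewrite gtn_sorted_uniq_geq sort_uniq uniq_hooks_of //=.
by apply: sort_sorted => a b; apply: leq_total.
Qed.

Lemma beta_core_of x : size x < n -> beta (core_of x) = sort geq (hooks_of x).
Proof. by move=> /sorted_hooks_of; apply: unbetaK. Qed.

(** The hooks sum to the size plus a binomial in the number of parts, which is [sumn x]. The
    identity is kept additive to avoid truncated subtraction. *)
Lemma sumn_core_of x : size x < n ->
  sumn (core_of x) + 'C(sumn x, 2)
  = site_sum x + n * sumn [seq 'C(a, 2) | a <- x].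
Proof.
move=> sx; rewrite -sumn_hooks_of -(size_hooks_of x).
rewrite -(perm_sumn (permEl (perm_sort geq (hooks_of x)))) -beta_core_of // sumn_beta.
by rewrite size_unbeta size_sort.
Qed.

Lemma height_inj x y : size x = size y ->
  (forall r, 0 < r <= size x -> height x r = height y r) -> x = y.
Proof.
move=> sxy H; apply: (@eq_from_nth _ 0) => // i ix.
by have := H (size x - i); rewrite /height -sxy subKn ?(ltnW ix) // => ->; lia.
Qed.

Lemma core_of_inj x y : size x = n.-1 -> size y = n.-1 ->
  core_of x = core_of y -> x = y.
Proof.
move=> sx sy E; apply: height_inj => [|r]; first by rewrite sx.
rewrite sx => rn.
have {}E z : (z \in hooks_of x) = (z \in hooks_of y).
  by rewrite -(mem_sort geq) -beta_core_of ?sx ?E ?beta_core_of ?sy ?mem_sort;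
    lia.
have H i : (i < height x r) = (i < height y r).
  have := E (i * n + r); rewrite !mem_hooks_of ?sx ?sy ?prednK //.
  rewrite modnMDl divnMDl // modn_small ?divn_small ?addn0; try lia.
have := H (height x r); have := H (height y r); lia.
Qed.

(** Lowering a hook by [n] keeps its residue and lowers its quotient, which gives closure under [n];
    no hook reaches [t], so closure under [t] is vacuous. Consecutive hooks would need adjacent
    nonzero letters. *)
Lemma core_of_distinct d t x : 0 < t -> x \in words d n.-1 ->
  (forall y, y \in hooks_of x -> y < t) -> distinct_cores n t (core_of x).
Proof.
move=> t0; rewrite mem_words => /and3P[/eqP sx _ /(sortedP 0) adj] bx.
have sxn : size x < n by rewrite sx prednK.
have hyE y : (y \in hooks_of x) = (y %/ n < height x (y %% n)).
  by rewrite mem_hooks_of // sx -ltnS prednK // ltn_mod n_gt0.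
have hx0 : height x 0 = 0 by rewrite /height subn0 nth_default.
have notin0 : 0 \notin sort geq (hooks_of x).
  by rewrite mem_sort hyE mod0n hx0.
have nosucc y : y \in sort geq (hooks_of x) -> y.+1 \notin sort geq (hooks_of x).
  rewrite !mem_sort !hyE; have yn := ltn_pmod y n_gt0.
  move: (y %/ n) (y %% n) (divn_eq y n) yn => q r yE yn.
  have -> : y.+1 = q * n + r.+1 by lia.
  (* When [r + 1 = n] the successor wraps to residue 0, whose height is 0. *)
  rewrite divnMDl // modnMDl; case: (ltngtP r.+1 n) yn => // [rn|->] _; last first.
    by rewrite modnn hx0.
  rewrite modn_small // divn_small // addn0.
  have := adj (size x - r.+1); rewrite /height.
  case: (posnP r) => [-> | r0]; first by rewrite -/(height x 0) hx0.
  have -> : (size x - r.+1).+1 = size x - r by lia.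
  have ltx : size x - r < size x by rewrite ltn_subrL r0 sx; case: (n) rn => [|[|n2]].
  by move=> /(_ ltx)/orP[/eqP->|/eqP->]; rewrite ltn0.
have /andP[sla la0] := unbeta_distinct (sorted_hooks_of sxn) notin0 nosucc.
move: (sla); rewrite gtn_sorted_uniq_geq => /andP[ula gla].
split=> //; first by rewrite /is_partition gla.
- apply/is_core_beta => // y; rewrite beta_core_of // !mem_sort !hyE => yx ny.
  have -> : (y - n) %% n = y %% n by rewrite -{2}(subnK ny) modnDr.
  by apply: leq_ltn_trans yx; apply: leq_div2r; lia.
- apply/is_core_beta => // y; rewrite beta_core_of // !mem_sort => /bx; lia.
Qed.

Lemma down_closed_height (P : pred nat) d :
  (forall i, P i.+1 -> P i) -> ~~ P d -> exists2 h, h <= d & P =1 gtn h.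
Proof.
move=> Pdown; elim: d => [|d IH] Pd.
  exists 0 => // i /=; rewrite [RHS]ltn0; apply/negP => Pi; case/negP: Pd.
  by elim: i Pi => // i IH /Pdown.
have [Pd'|/IH[h hd Ph]] := boolP (P d); last by exists h => //; apply: leqW.
exists d.+1 => // i /=; apply/idP/idP => [Pi|].
  rewrite ltnNge; apply/negP => di; case/negP: Pd; rewrite -(subnKC di) in Pi.
  by elim: (i - _) Pi => [|k IHk]; rewrite ?addn0 // addnS => /Pdown.
rewrite ltnS => id; rewrite -(subKn id).
elim: (d - i) => [|k IHk]; first by rewrite subn0.
by rewrite subnS; case: (d - k) IHk => // j /Pdown.
Qed.

Lemma exists_word (Q : nat -> nat -> Prop) N :
  (forall r, 0 < r <= N -> exists h, Q r h) ->
  exists2 x, size x = N & forall r, 0 < r <= N -> Q r (height x r).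
Proof.
elim: N => [|N IH] QN; first by exists [::] => // r; lia.
have [r rN|x sx Qx] := IH; first by apply: QN; lia.
have [|a Qa] := QN N.+1; first by lia.
exists (a :: x) => [|r rN]; first by rewrite /= sx.
have [->|rN'] := eqVneq r N.+1; first by rewrite /height /= sx subnn.
rewrite /height /= sx subSn /=; last by lia.
by rewrite -sx; apply: Qx; lia.
Qed.

(** In each nonzero residue class the hooks form an initial segment, of length at most [d] because
    [r + d * n] is missing; these lengths are the letters. Residue 0 is empty, since descending by
    [n] would reach the hook 0. *)
Lemma distinct_core_of d t la : 0 < t -> distinct_cores n t la ->
  (forall r, 0 < r < n -> r + d * n \notin beta la) ->
  exists2 x, x \in words d n.-1 & core_of x = la.
Proof.
move=> t0 [/andP[gla la0] ula /(is_core_beta n_gt0 gla) nla _] dla.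
have sla : sorted gtn la by rewrite gtn_sorted_uniq_geq ula.
have nosucc y := @beta_no_succ la y sla.
have la0n i : i * n \notin beta la.
  elim: i => [|i IH]; first by rewrite beta_neq0.
  apply/negP => /nla; rewrite mulSn addKn => /(_ (leq_addr _ _)).
  by apply/negP.
have [r rn|x sx Qx] := @exists_word
    (fun r h => h <= d /\ forall i, (r + i * n \in beta la) = (i < h)) n.-1.
  have [i||h hd Qh] := @down_closed_height (fun i => r + i * n \in beta la) d.
  - move=> /nla; have -> : r + i.+1 * n - n = r + i * n by lia.
    by apply; lia.
  - by apply: dla; lia.
  - by exists h.
have mem_x y : (y \in hooks_of x) = (y \in beta la).
  rewrite mem_hooks_of sx ?prednK // -ltnS prednK // ltn_mod n_gt0 /=.
  have yn := ltn_pmod y n_gt0; rewrite {3}(divn_eq y n).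
  case: (posnP (y %% n)) => [->|yn0].
    by rewrite /height subn0 nth_default // ltn0 addn0 (negPf (la0n _)).
  by have [|_ <-] := Qx (y %% n); [lia | rewrite addnC].
exists x; last first.
  rewrite -(betaK la) /core_of; congr unbeta.
  apply: (irr_sorted_eq (rev_trans ltn_trans)) => [y|||y].
  - exact: ltnn.
  - by rewrite sorted_hooks_of // sx prednK.
  - by rewrite sorted_beta.
  - by rewrite mem_sort.
rewrite mem_words sx eqxx /=; apply/andP; split.
  apply/(all_nthP 0) => i ix; have [|] := Qx (size x - i); first by lia.
  by rewrite /height subKn // ltnW.
apply/(sortedP 0) => i ix; rewrite -[no_adjacent _ _]negbK negb_or -!lt0n.
apply/negP => /andP[i0 i1].
have [|_ H0] := Qx (size x - i); first by lia.
have [|_ H1] := Qx (size x - i.+1); first by lia.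
(* Two adjacent nonzero letters would make two consecutive residues hooks. *)
move: (H0 0) (H1 0); rewrite /height !subKn ?i0 ?i1 ?(ltnW ix) 1?ltnW //.
rewrite !mul0n !addn0 => H0' /nosucc; have -> : (size x - i.+1).+1 = size x - i.
  by lia.
  by rewrite H0'.
exact: ltnW.
Qed.

End FirstColumnHooks.

(** * Both families of cores as images of words *)

Definition words_minus (d N : nat) : seq (seq nat) :=
  [seq x <- words d N | head 0 x < d].

(** Letters at most [d] keep all hooks below [d * n]. Conversely, a hook [r + d * n] would yield the
    hook [r] by subtracting [n] repeatedly and the hook [r - 1] by subtracting [d * n + 1], two
    consecutive integers. *)
Lemma distinct_cores_plus n d : 1 < n ->
  distinct_cores n (d * n + 1)
  = [set` [seq core_of n x | x <- words d n.-1]]%classic.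
Proof.
move=> n1; have n0 : 0 < n by lia.
apply/seteqP; split=> la; last first.
  move=> /mapP[x xw ->]; apply: (@core_of_distinct n n0 d) => //; first by lia.
  move=> y; rewrite mem_hooks_of ?(size_words xw) ?prednK // => /andP[_ yx].
  have : height x (y %% n) <= d.
    move: xw; rewrite mem_words /height => /and3P[_ /(all_nthP 0) xd _].
    have [/xd //|/(nth_default 0)->//] := ltnP (size x - y %% n) (size x).
  move=> hd; have {}yx : y %/ n < d by exact: leq_trans yx hd.
  by rewrite ltn_divLR // in yx; lia.
move=> laA; have [/andP[gla la0] ula cn ct] := laA.
have sla : sorted gtn la by rewrite gtn_sorted_uniq_geq ula.
have t0 : 0 < d * n + 1 by lia.
have [r rn|x xw <-] := @distinct_core_of n n0 d _ la t0 laA.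
- apply/negP => rla; move/(is_core_beta n0 gla): cn => cn.
  have rla' : r \in beta la.
    elim: (d) rla => [|i IH]; first by rewrite addn0.
    move=> /cn; have -> : r + i.+1 * n - n = r + i * n by lia.
    by move=> H; apply/IH/H; lia.
  have := (is_core_beta t0 gla).1 ct _ rla.
  have -> : r + d * n - (d * n + 1) = r.-1 by lia.
  move=> /(_ _)/(beta_no_succ sla); rewrite prednK ?rla'; [|lia].
  by move=> H; have := H ltac:(lia).
- by apply/mapP; exists x.
Qed.

(** As before, but a hook [r + d * n] now yields [r] and [r + 1]. The first letter has residue
    [n - 1]; if it were [d], then [d * n - 1] would be a hook and subtracting it would give the hook
    0. *)
Lemma distinct_cores_minus n d : 1 < n -> 0 < d ->
  distinct_cores n (d * n - 1)
  = [set` [seq core_of n x | x <- words_minus d n.-1]]%classic.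
Proof.
move=> n1 d0; have n0 : 0 < n by lia.
have t0 : 0 < d * n - 1 by nia.
apply/seteqP; split=> la; last first.
  move=> /mapP[x]; rewrite mem_filter => /andP[xd xw] ->.
  apply: (@core_of_distinct n n0 d) => // y.
  have sx := size_words xw.
  rewrite mem_hooks_of ?sx ?prednK // => /andP[_ yx].
  have : height x (y %% n) <= d.
    move: xw; rewrite mem_words /height => /and3P[_ /(all_nthP 0) xd' _].
    have [/xd' //|/(nth_default 0)->//] := ltnP (size x - y %% n) (size x).
  move=> hd; have yd : y %/ n < d by exact: leq_trans yx hd.
  have yn := ltn_pmod y n0; have yE := divn_eq y n.
  have [yn1|yn1] := eqVneq (y %% n) n.-1; last by nia.
  move: yx; rewrite yn1 /height sx subnn nth0 => yx; nia.
move=> laA; have [/andP[gla la0] ula cn ct] := laA.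
have sla : sorted gtn la by rewrite gtn_sorted_uniq_geq ula.
move/(is_core_beta n0 gla): cn => cn.
move/(is_core_beta t0 gla): ct => ct.
have [r rn|x xw xE] := @distinct_core_of n n0 d _ la t0 laA.
- apply/negP => rla.
  have rla' : r \in beta la.
    elim: (d) rla => [|i IH]; first by rewrite addn0.
    move=> /cn; have -> : r + i.+1 * n - n = r + i * n by lia.
    by move=> H; apply/IH/H; lia.
  have := ct _ rla; have -> : r + d * n - (d * n - 1) = r.+1 by nia.
  by rewrite (negPf (beta_no_succ sla rla')) => H; have := H ltac:(nia).
- apply/mapP; exists x => //; rewrite mem_filter xw andbT ltnNge.
  have sx := size_words xw; apply/negP => dx.
  have : d * n - 1 \in beta la.
    rewrite -xE beta_core_of ?sx ?prednK // mem_sort.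
    have -> : d * n - 1 = d.-1 * n + n.-1 by nia.
    rewrite mem_hooks_of ?sx ?prednK // modnMDl divnMDl //.
    rewrite modn_small ?divn_small ?prednK // addn0 leqnn /height sx subnn nth0.
    by lia.
  move=> /ct; rewrite subnn => /(_ (leqnn _)); apply/negP.
  exact: beta_neq0.
Qed.

Import Order.TTheory GRing.Theory Num.Theory.
Import numFieldNormedType.Exports.

Local Open Scope ring_scope.

(** * Additive functionals of words *)

Section AdditiveFunctionals.
Variables (R : rcfType) (d : nat).

Lemma sum_words_rec (V : nmodType) (G : seq nat -> V) N :
  \sum_(x <- words d N.+2) G x =
  \sum_(x <- words d N.+1) G (0%N :: x)
  + \sum_(x <- words d N) \sum_(0 <= j < d) G (j.+1 :: 0%N :: x).
Proof.
rewrite words_rec big_cat big_map big_allpairs_dep exchange_big /=.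
by rewrite /index_iota subn0.
Qed.

(** * Word counts and their growth rate *)

Definition num_words N : R := (size (words d N))%:R.
Local Notation F := num_words.

Lemma sum_words_cst N (c : R) : \sum_(x <- words d N) c = c * F N.
Proof. by rewrite big_const_seq count_predT iter_addr_0 mulr_natr. Qed.

Lemma num_words0 : F 0 = 1. Proof. by []. Qed.

Lemma num_words1 : F 1 = d%:R + 1.
Proof. by rewrite /F /words size_map size_iota -addn1 natrD. Qed.

Lemma num_words_rec N : F N.+2 = F N.+1 + d%:R * F N.
Proof.
rewrite /F words_rec size_cat size_map size_allpairs size_iota.
by rewrite natrD natrM.
Qed.

Lemma num_words_ge1 N : 1 <= F N.
Proof.
elim: N => [|[_|N IH]]; first by rewrite num_words0.
  by rewrite num_words1 lerDr.
by rewrite num_words_rec; apply: ler_wpDr => //; rewrite mulr_ge0.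
Qed.

(** The positive root of [X^2 = X + d]; the other root is [1 - lam]. *)
Definition growth_rate : R := (1 + Num.sqrt (1 + 4 * d%:R)) / 2.
Local Notation lam := growth_rate.

Lemma growth_rate_sqr : lam ^+ 2 = lam + d%:R.
Proof.
have /sqr_sqrtr : 0 <= 1 + 4 * d%:R :> R by rewrite addr_ge0 // mulr_ge0.
rewrite /growth_rate; set s := Num.sqrt _ => ss.
have -> : d%:R = (s ^+ 2 - 1) / 4 :> R by rewrite ss; field.
by field.
Qed.

Lemma growth_rate_ge1 : 1 <= lam.
Proof.
have : Num.sqrt 1 <= Num.sqrt (1 + 4 * d%:R) :> R.
  by apply: ler_wsqrtr; rewrite lerDl mulr_ge0.
rewrite sqrtr1 /growth_rate; lra.
Qed.

Lemma growth_rate_le : lam - 1 <= d%:R.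
Proof.
have -> : d%:R = (lam - 1) + (lam - 1) ^+ 2 :> R.
  by have := growth_rate_sqr; rewrite sqrrB expr1n; lra.
by rewrite lerDl sqr_ge0.
Qed.

(** The combination cancels the dominant root, leaving a geometric sequence in [1 - lam]; its
    initial value is [d + 1 - lam = (1 - lam)^2]. *)
Lemma num_words_defect N : F N.+1 - lam * F N = (1 - lam) ^+ N.+2.
Proof.
have d_lam : d%:R = lam ^+ 2 - lam :> R by rewrite growth_rate_sqr; ring.
elim: N => [|N IH]; first by rewrite num_words1 num_words0 d_lam; ring.
by rewrite num_words_rec exprS -IH d_lam; ring.
Qed.

Lemma norm_num_words_defect N : `|F N.+1 - lam * F N| = (lam - 1) ^+ N.+2.
Proof.
rewrite num_words_defect normrX distrC ger0_norm //.
by rewrite subr_ge0 growth_rate_ge1.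
Qed.

(** Positions are counted from the right, so a letter keeps its weight when further letters are
    prepended. *)
Fixpoint weighted_sum (g w : nat -> R) (x : seq nat) : R :=
  if x is a :: x' then w (size x').+1 * g a + weighted_sum g w x' else 0.

(** * First and second moments of centred weighted sums *)

Section Bounds.
Variables (g w : nat -> R) (phi W delta : R) (M : nat).
Hypothesis phi_ge0 : 0 <= phi.
Hypothesis g_le : forall a, (a <= d)%N -> `|g a| <= phi.
(* [g] has mean zero under the limiting distribution of a letter, which gives
   weight [lam + d] to [0] and weight [1] to each nonzero letter. *)
Hypothesis g_mean0 : \sum_(0 <= j < d) g j.+1 = - (lam + d%:R) * g 0%N.
Hypothesis W_ge0 : 0 <= W.
Hypothesis w_le : forall r, (0 < r <= M)%N -> `|w r| <= W.
Hypothesis delta_ge0 : 0 <= delta.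
Hypothesis w_var : forall r, `|w r.+1 - w r| <= delta.
Local Notation Z := (weighted_sum g w).

Lemma letter_le r a : (0 < r <= M)%N -> (a <= d)%N -> `|w r * g a| <= phi * W.
Proof.
move=> rM ad; rewrite normrM mulrC; apply: ler_pM => //; first exact: g_le.
exact: w_le.
Qed.

Lemma weighted_sum_le x : (size x <= M)%N -> all (geq d) x ->
  `|Z x| <= phi * W * (size x)%:R.
Proof.
elim: x => [|a x IH] /=; first by rewrite normr0 mulr0.
move=> sx /andP[ad xd]; rewrite -addn1 natrD mulrDr mulr1 addrC.
apply: le_trans (ler_normD _ _) _; rewrite lerD ?IH ?letter_le //; lia.
Qed.

(** Prepended blocks contribute the last term. The mean-zero condition replaces the sum over nonzero
    letters by a multiple of [g 0], which leaves only the geometric defect and the variation of the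
    weights. *)
Lemma sum_weighted_sum_rec N :
  \sum_(x <- words d N.+2) Z x =
  \sum_(x <- words d N.+1) Z x + d%:R * \sum_(x <- words d N) Z x
  + g 0%N * (w N.+2 * (F N.+1 - lam * F N)
             - d%:R * (w N.+2 - w N.+1) * F N).
Proof.
rewrite sum_words_rec.
rewrite (eq_big_seq (fun x => w N.+2 * g 0%N + Z x)); last first.
  by move=> x /size_words /= ->.
rewrite [X in _ + X = _](eq_big_seq (fun x =>
   (- w N.+2 * (lam + d%:R) * g 0%N + d%:R * w N.+1 * g 0%N) + d%:R * Z x));
  last first.
  move=> x /size_words /= ->; rewrite big_split /= -mulr_sumr g_mean0.
  by rewrite sumr_const_nat subn0 -mulr_natl; ring.
by rewrite !big_split /= !sum_words_cst -mulr_sumr; ring.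
Qed.

Let K := phi * d%:R.

(* The term [- K * (lam - 1) ^+ N] absorbs the defect
   [F N.+1 - lam * F N] in the induction. *)
Lemma sum_weighted_sum_sharp N : (N <= M)%N ->
  `|\sum_(x <- words d N) Z x|
  <= W * ((phi + K) * F N - K * (lam - 1) ^+ N) + delta * phi * N%:R * F N.
Proof.
have K0 : 0 <= K by rewrite mulr_ge0.
have nu0 : 0 <= lam - 1 by rewrite subr_ge0 growth_rate_ge1.
have nud := growth_rate_le.
elim/ltn_ind: N => -[|[|N]] IH NM.
- rewrite /words big_seq1 /= normr0 num_words0 expr0 !mulr1 mulr0 addr0.
  by rewrite addrK mulr_ge0.
- have : `|\sum_(x <- words d 1) Z x| <= phi * W * F 1.
    rewrite -sum_words_cst; apply: le_trans (ler_norm_sum _ _ _) _.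
    rewrite big_seq [leRHS]big_seq; apply: ler_sum => x xw.
    have sx := size_words xw; move: xw; rewrite mem_words => /and3P[_ xd _].
    by have := weighted_sum_le _ xd; rewrite sx mulr1; apply.
  move/le_trans; apply; rewrite num_words1 expr1.
  have -> : W * ((phi + K) * (d%:R + 1) - K * (lam - 1)) =
      phi * W * (d%:R + 1) + W * (K * (d%:R - (lam - 1) + 1)) by ring.
  rewrite -addrA lerDl addr_ge0 ?mulr_ge0 //; lra.
have := IH N.+1 (ltnSn _) (ltnW NM).
have := IH N (ltnW (ltnSn _)) (ltnW (ltnW NM)).
rewrite sum_weighted_sum_rec; set S0 := \sum_(x <- _) _.
set S1 := \sum_(x <- _) _; move=> H0 H1.
have F0 : 0 <= F N by rewrite (le_trans _ (num_words_ge1 N)).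
have F1 : 0 <= F N.+1 by rewrite (le_trans _ (num_words_ge1 N.+1)).
have drift : `|g 0%N * (w N.+2 * (F N.+1 - lam * F N)
             - d%:R * (w N.+2 - w N.+1) * F N)|
    <= phi * (W * (lam - 1) ^+ N.+2 + d%:R * delta * F N).
  rewrite normrM ler_pM ?g_le //; apply: le_trans (ler_normB _ _) _.
  rewrite normrM norm_num_words_defect !normrM normr_nat (ger0_norm F0).
  rewrite lerD // ?ler_wpM2r ?exprn_ge0 ?w_le //.
  by rewrite ler_wpM2l.
have dS0 : `|d%:R * S0| = d%:R * `|S0| by rewrite normrM normr_nat.
apply: le_trans (ler_normD _ _) _.
apply: le_trans (lerD (ler_normD _ _) drift) _; rewrite dS0.
apply: le_trans (lerD (lerD H1 (ler_wpM2l (ler0n R d) H0)) (lexx _)) _.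
(* The equation for [lam] reads [(lam - 1)^2 = d - (lam - 1)]. *)
have nu2 : (lam - 1) ^+ N.+2 = (d%:R - (lam - 1)) * (lam - 1) ^+ N.
  rewrite -addn2 exprD mulrC; congr (_ * _).
  by have := growth_rate_sqr; rewrite sqrrB expr1n; lra.
have P : 0 <= (lam - 1) ^+ N by rewrite exprn_ge0.
rewrite num_words_rec nu2 (exprS _ N) -subr_ge0.
rewrite (_ : N.+2%:R = N%:R + 2); last by rewrite -addn2 natrD.
rewrite (_ : N.+1%:R = N%:R + 1); last by rewrite -addn1 natrD.
have zero : (lam - 1) ^+ 2 + (lam - 1) - d%:R = 0.
  by have := growth_rate_sqr; rewrite sqrrB expr1n; lra.
(* The last summand is a multiple of a polynomial vanishing at [lam]; adding it makes the identity
   formal. *)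
rewrite [leRHS](_ : _ =
  W * phi * (lam - 1) ^+ N * (lam - 1) * (d%:R + (d%:R - (lam - 1)))
  + delta * phi * (F N.+1 + d%:R * F N)
  + W * phi * (lam - 1) ^+ N * ((lam - 1) ^+ 2 + (lam - 1) - d%:R)); last first.
  by rewrite /K; ring.
have nud' : 0 <= d%:R - (lam - 1) by rewrite subr_ge0.
rewrite zero mulr0 addr0 addr_ge0 ?mulr_ge0 ?(addr_ge0 _ nud') ?exprn_ge0 //.
by rewrite addr_ge0 // mulr_ge0.
Qed.

(** Dominates both the bound on the mean of [Z] and [2 * phi * W], the size of a prepended
    two-letter block. It depends on [M] and not on [N], so it stays fixed during the induction. *)
Let B := phi * (2 + d%:R) * (W + delta * M%:R).

Lemma phi_W_le : phi * W <= B.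
Proof.
have D0 : 0 <= delta * M%:R by rewrite mulr_ge0.
have D1 : 0 <= d%:R * (W + delta * M%:R) by rewrite mulr_ge0 // addr_ge0.
by rewrite /B -mulrA ler_wpM2l // mulrDl; have := W_ge0; lra.
Qed.

Lemma sum_weighted_sum_le N : (N <= M)%N ->
  `|\sum_(x <- words d N) Z x| <= B * F N.
Proof.
move=> NM; apply: le_trans (sum_weighted_sum_sharp NM) _.
have F0 : 0 <= F N by rewrite (le_trans _ (num_words_ge1 N)).
have P : 0 <= K * (lam - 1) ^+ N.
  by rewrite !mulr_ge0 // exprn_ge0 // subr_ge0 growth_rate_ge1.
have NM' : N%:R <= M%:R :> R by rewrite ler_nat.
have H1 : W * ((phi + K) * F N - K * (lam - 1) ^+ N) <= W * ((phi + K) * F N).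
  by rewrite ler_wpM2l // lerBlDr lerDl.
have H2 : delta * phi * N%:R * F N <= delta * phi * M%:R * F N.
  by rewrite ler_wpM2r // ler_wpM2l // mulr_ge0.
apply: le_trans (lerD H1 H2) _; rewrite -subr_ge0.
rewrite [leRHS](_ : _ =
  phi * W * F N + phi * (1 + d%:R) * (delta * M%:R) * F N); last first.
  by rewrite /B /K; ring.
by rewrite !(addr_ge0, mulr_ge0).
Qed.

(** Prepending a block replaces [Z] by [c + Z] with [c] bounded by [B]. The first-moment bound
    controls the cross term, so the mean square gains only a constant per step and grows
    linearly. *)
Lemma sum_weighted_sum_sqr_le N : (N <= M)%N ->
  \sum_(x <- words d N) Z x ^+ 2 <= 3 * B ^+ 2 * N%:R * F N.
Proof.
have B0 : 0 <= B by apply: le_trans phi_W_le; rewrite mulr_ge0.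
elim/ltn_ind: N => -[|[|N]] IH NM.
- by rewrite /words big_seq1 /= expr0n mulr0 mul0r.
- rewrite mulr1 -sum_words_cst big_seq [leRHS]big_seq.
  apply: ler_sum => x xw.
  have sx := size_words xw; move: xw; rewrite mem_words => /and3P[_ xd _].
  have Zx : `|Z x| <= B.
    apply: le_trans phi_W_le; rewrite -[phi * W]mulr1.
    by have := weighted_sum_le _ xd; rewrite sx; apply.
  rewrite -real_normK ?num_real //.
  have : `|Z x| ^+ 2 <= B ^+ 2 by rewrite ler_pXn2r ?nnegrE.
  by have := sqr_ge0 B; lra.
have F0 : 0 <= F N by rewrite (le_trans _ (num_words_ge1 N)).
have F1 : 0 <= F N.+1 by rewrite (le_trans _ (num_words_ge1 N.+1)).
(* The 3 counts [c ^+ 2] once and the cross term [c * Z] twice, each at most [B ^+ 2] on average. *)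
have step c N' : `|c| <= B -> (N' <= M)%N ->
    \sum_(x <- words d N') (c + Z x) ^+ 2
    <= \sum_(x <- words d N') Z x ^+ 2 + 3 * B ^+ 2 * F N'.
  move=> cB NM'; rewrite (eq_bigr (fun x => c ^+ 2 + (c * Z x + c * Z x) + Z x ^+ 2));
    last by move=> x _; rewrite sqrrD mulr2n.
  rewrite !big_split /= sum_words_cst -mulr_sumr.
  rewrite addrC lerD2l.
  have H1 : `|c * \sum_(x <- words d N') Z x| <= B * (B * F N').
    by rewrite normrM ler_pM // sum_weighted_sum_le.
  have H2 : c ^+ 2 * F N' <= B ^+ 2 * F N'.
    rewrite ler_wpM2r ?(le_trans _ (num_words_ge1 N')) //.
    by rewrite -real_normK ?num_real // ler_pXn2r ?nnegrE.
  have := ler_norm (c * \sum_(x <- words d N') Z x).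
  rewrite (_ : 3 * B ^+ 2 * F N' = B ^+ 2 * F N' + (B * (B * F N') + B * (B * F N'))).
    by move: H1 H2; lra.
  by ring.
rewrite sum_words_rec.
rewrite (eq_big_seq (fun x => (w N.+2 * g 0%N + Z x) ^+ 2)); last first.
  by move=> x /size_words /= ->.
rewrite [X in _ + X <= _](eq_big_seq (fun x => \sum_(0 <= j < d)
   ((w N.+2 * g j.+1 + w N.+1 * g 0%N) + Z x) ^+ 2)); last first.
  by move=> x /size_words /= ->; apply: eq_bigr => j _; rewrite addrA.
rewrite exchange_big /=.
have H1 := step (w N.+2 * g 0%N) N.+1.
have H0 : \sum_(0 <= j < d) \sum_(x <- words d N)
    (w N.+2 * g j.+1 + w N.+1 * g 0%N + Z x) ^+ 2
  <= d%:R * (\sum_(x <- words d N) Z x ^+ 2 + 3 * B ^+ 2 * F N).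
  rewrite mulr_natl -[X in _ *+ X]subn0 -sumr_const_nat.
  rewrite big_nat [leRHS]big_nat; apply: ler_sum => j /andP[_ jd].
  apply: step; last by lia.
  apply: le_trans (ler_normD _ _) _.
  apply: le_trans (lerD (letter_le _ _) (letter_le _ _)) _; rewrite ?NM //; try lia.
  have D0 : 0 <= phi * (delta * M%:R) by rewrite !mulr_ge0.
  have D1 : 0 <= phi * (d%:R * (W + delta * M%:R)).
    by rewrite mulr_ge0 // mulr_ge0 // addr_ge0 // mulr_ge0.
  by rewrite /B; lra.
apply: le_trans (lerD (H1 _ _) H0) _; last 1 first.
- have I1 := IH N.+1 (ltnSn _) (ltnW NM).
  have I0 := IH N (ltnW (ltnSn _)) (ltnW (ltnW NM)).
  apply: le_trans (lerD (lerD I1 (lexx _))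
    (ler_wpM2l (ler0n R d) (lerD I0 (lexx _)))) _.
  rewrite num_words_rec -subr_ge0.
  rewrite (_ : N.+2%:R = N%:R + 2); last by rewrite -addn2 natrD.
  rewrite (_ : N.+1%:R = N%:R + 1); last by rewrite -addn1 natrD.
  rewrite [leRHS](_ : _ = 3 * B ^+ 2 * (d%:R * F N)); last by ring.
  by rewrite mulr_ge0 ?(mulr_ge0 _ F0) // mulr_ge0 ?sqr_ge0.
- by apply: le_trans phi_W_le; apply: letter_le.
- exact: ltnW.
Qed.

End Bounds.
End AdditiveFunctionals.

(** * Concentration of the size *)

(** First-order Taylor expansion with a remainder uniform on [|y| <= K]. The recursion for [D]
    produces [k c^(k-1)]. *)
Lemma expr_linear_approx (R : realFieldType) (c K : R) k : 0 <= K ->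
  exists D C, 0 <= C /\ forall y, `|y| <= K ->
    `|(c + y) ^+ k - c ^+ k - D * y| <= C * y ^+ 2.
Proof.
move=> K0; elim: k => [|k [D [C [C0 H]]]].
  exists 0, 0; split=> // y _; rewrite !expr0 mul0r subrr subr0 normr0.
  by rewrite mul0r.
exists (c * D + c ^+ k), ((`|c| + K) * C + `|D|).
split=> [|y yK]; first by rewrite addr_ge0 ?mulr_ge0 ?addr_ge0.
have -> : (c + y) ^+ k.+1 - c ^+ k.+1 - (c * D + c ^+ k) * y =
  (c + y) * ((c + y) ^+ k - c ^+ k - D * y) + D * y ^+ 2 by rewrite !exprS; ring.
apply: le_trans (ler_normD _ _) _; rewrite [leRHS]mulrDl normrM [`|D * _|]normrM normrX -mulrA.
rewrite real_normK ?num_real // lerD2r ler_pM //; last exact: H.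
by apply: le_trans (ler_normD _ _) _; rewrite lerD2l.
Qed.

(** Rescale by [y = Y / n^2]. On average the linear term is [O(1/n)] by the bound on the sum of [Y],
    and the quadratic remainder is [O(1/n)] by the bound on the sum of squares. [K'] is chosen
    before the list and [n]. *)
Lemma sum_expr_concentrated (R : realFieldType) (T : eqType) (c K : R) k :
  (0 < k)%N -> 0 <= K -> exists K', forall (r : seq T) (X : T -> R) (n : R),
    1 <= n -> let Y x := X x - c * n ^+ 2 in
    (forall x, x \in r -> `|Y x| <= K * n ^+ 2) ->
    `|\sum_(x <- r) Y x| <= K * n * (size r)%:R ->
    \sum_(x <- r) Y x ^+ 2 <= K * n ^+ 3 * (size r)%:R ->
    `|\sum_(x <- r) X x ^+ k - c ^+ k * n ^+ (2 * k) * (size r)%:R|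
    <= K' * n ^+ (2 * k - 1) * (size r)%:R.
Proof.
move=> k0 K0; have [D [C [C0 H]]] := expr_linear_approx c k K0.
exists (`|D| * K + C * K) => r X n n1 Y HY S1 S2.
have n0 : 0 < n by rewrite (lt_le_trans _ n1).
have nn : n != 0 by rewrite gt_eqF.
pose y x := Y x / n ^+ 2.
have XE x : X x = n ^+ 2 * (c + y x) by rewrite /y /Y; field.
have cst (a : R) : \sum_(x <- r) a = a * (size r)%:R.
  by rewrite big_const_seq count_predT iter_addr_0 mulr_natr.
have -> : \sum_(x <- r) X x ^+ k - c ^+ k * n ^+ (2 * k) * (size r)%:R =
  n ^+ (2 * k) * (\sum_(x <- r) ((c + y x) ^+ k - c ^+ k - D * y x)
                  + D * \sum_(x <- r) y x).
  rewrite -cst -sumrB mulr_sumr -big_split /= mulr_sumr.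
  by apply: eq_bigr => x _; rewrite XE exprMn -exprM; ring.
rewrite normrM ger0_norm ?exprn_ge0 ?(ltW n0) //.
have B1 : `|\sum_(x <- r) ((c + y x) ^+ k - c ^+ k - D * y x)|
    <= C * K / n * (size r)%:R.
  apply: le_trans (ler_norm_sum _ _ _) _.
  have : \sum_(x <- r) `|(c + y x) ^+ k - c ^+ k - D * y x|
      <= \sum_(x <- r) C / n ^+ 4 * Y x ^+ 2.
    rewrite big_seq [leRHS]big_seq; apply: ler_sum => x xr.
    have -> : C / n ^+ 4 * Y x ^+ 2 = C * y x ^+ 2 by rewrite /y; field.
    apply: H; rewrite /y normrM normfV [`|n ^+ 2|]ger0_norm ?exprn_ge0 ?(ltW n0) //.
    by rewrite ler_pdivrMr ?exprn_gt0 // HY.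
  move/le_trans; apply; rewrite -mulr_sumr.
  have -> : C * K / n * (size r)%:R = C / n ^+ 4 * (K * n ^+ 3 * (size r)%:R).
    by field.
  by rewrite ler_wpM2l // divr_ge0 // exprn_ge0 // ltW.
have B2 : `|D * \sum_(x <- r) y x| <= `|D| * K / n * (size r)%:R.
  rewrite normrM -!mulrA ler_wpM2l // -mulr_suml normrM normfV.
  rewrite [`|n ^+ 2|]ger0_norm ?exprn_ge0 ?(ltW n0) // ler_pdivrMr ?exprn_gt0 //.
  by have -> : K * (n^-1 * (size r)%:R) * n ^+ 2 = K * n * (size r)%:R by field.
apply: le_trans (ler_wpM2l _ (le_trans (ler_normD _ _) (lerD B1 B2))) _.
  by rewrite exprn_ge0 // ltW.
(* Positivity of [k] ensures that [2 * k - 1] is not truncated. *)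
have -> : n ^+ (2 * k) = n * n ^+ (2 * k - 1).
  by rewrite -exprS -subSn ?muln_gt0 ?k0 // subn1.
by rewrite le_eqVlt; apply/orP; left; apply/eqP; field.
Qed.

(** * Concentration for both families of words *)

Section Concentration.
Variables (R : rcfType) (d : nat).
Hypothesis d_gt0 : (0 < d)%N.
Local Notation F := (@num_words R d).
Local Notation lam := (growth_rate R d).

(** Mean under weight [lam + d] on 0 and weight 1 on each nonzero letter, of total [lam + 2 d]. The
    letter 0 has no term because the functions of interest vanish there. *)
Definition letter_mean (f : nat -> R) : R :=
  (\sum_(0 <= j < d) f j.+1) / (lam + 2 * d%:R).

Definition centered (f : nat -> R) (a : nat) : R := f a - letter_mean f.

Lemma centered_mean0 f : f 0%N = 0 ->
  \sum_(0 <= j < d) centered f j.+1 = - (lam + d%:R) * centered f 0%N.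
Proof.
move=> f0; rewrite sumrB sumr_const_nat subn0 /centered f0 -mulr_natl.
rewrite /letter_mean; field; rewrite gt_eqF // ltr_wpDr ?mulr_ge0 //.
by rewrite (lt_le_trans _ (growth_rate_ge1 R d)).
Qed.

(** The interface shared by the two families. [C] depends on [f] but not on the weights: constant
    weights give [B = O(1)], weights [w r = r] give [B = O(N)]. *)
Definition concentrated (s : nat -> seq (seq nat)) : Prop :=
  forall f : nat -> R, f 0%N = 0 -> exists2 C : R, 0 <= C &
  forall N w W delta, (1 < N)%N -> 0 <= W -> 0 <= delta ->
    (forall r, (0 < r <= N)%N -> `|w r| <= W) ->
    (forall r, `|w r.+1 - w r| <= delta) ->
    let Z := weighted_sum (centered f) w in
    let B := C * (W + delta * N%:R) in
    [/\ forall x, x \in s N -> `|Z x| <= B * N%:R,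
        `|\sum_(x <- s N) Z x| <= B * (size (s N))%:R
      & \sum_(x <- s N) Z x ^+ 2 <= B ^+ 2 * N%:R * (size (s N))%:R].

Lemma words_bounds f : f 0%N = 0 -> exists2 phi : R, 0 <= phi &
  forall N w W delta, 0 <= W -> 0 <= delta ->
    (forall r, (0 < r <= N)%N -> `|w r| <= W) ->
    (forall r, `|w r.+1 - w r| <= delta) ->
    let Z := weighted_sum (centered f) w in
    let B := phi * (W + delta * N%:R) in
    [/\ forall r a, (0 < r <= N)%N -> (a <= d)%N -> `|w r * centered f a| <= B,
        forall x, (size x <= N)%N -> all (geq d) x -> `|Z x| <= B * (size x)%:R,
        forall M, (M <= N)%N -> `|\sum_(x <- words d M) Z x| <= B * F M
      & \sum_(x <- words d N) Z x ^+ 2 <= 3 * B ^+ 2 * N%:R * F N].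
Proof.
move=> f0; pose phi := \sum_(0 <= a < d.+1) `|centered f a|.
have phi0 : 0 <= phi by apply: sumr_ge0.
have phi_le a : (a <= d)%N -> `|centered f a| <= phi.
  move=> ad; rewrite /phi (big_rem a) ?mem_index_iota //=.
  by rewrite lerDl sumr_ge0.
exists (phi * (2 + d%:R)); first by rewrite mulr_ge0 // addr_ge0.
move=> N w W delta W0 delta0 wW wd Z B.
have PW : phi * W <= B by apply: phi_W_le.
split=> [r a rN ad|x xN xd|M MN|].
- by apply: le_trans PW; apply: letter_le rN ad.
- apply: (@le_trans _ _ (phi * W * (size x)%:R)); last by rewrite ler_wpM2r.
  exact: (weighted_sum_le phi0 phi_le W0 wW delta0).
- exact: (sum_weighted_sum_le phi0 phi_le (centered_mean0 f0) W0 wW delta0).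
- exact: (sum_weighted_sum_sqr_le phi0 phi_le (centered_mean0 f0) W0 wW delta0).
Qed.

Lemma words_concentrated : concentrated (words d).
Proof.
move=> f f0; have [phi phi0 H] := words_bounds f0.
exists (3 * phi); first by rewrite mulr_ge0.
move=> N w W delta N1 W0 delta0 wW wd Z B.
have [_ H1 H2 H3] := H N w W delta W0 delta0 wW wd.
have B0 : 0 <= phi * (W + delta * N%:R) by rewrite mulr_ge0 // addr_ge0 // mulr_ge0.
have BE : B = 3 * (phi * (W + delta * N%:R)) by rewrite /B mulrA.
split=> [x xw||].
- have sx := size_words xw; move: xw; rewrite mem_words => /and3P[_ xd _].
  apply: le_trans (H1 x _ xd) _; rewrite sx // ler_wpM2r // BE; lra.
- by apply: le_trans (H2 N _) _ => //; rewrite ler_wpM2r // BE; lra.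
- apply: le_trans H3 _; rewrite BE; move: (phi * _) B0 => b B0.
  rewrite ler_wpM2r // ler_wpM2r // exprMn ler_wpM2r ?sqr_ge0 //.
  by lra.
Qed.

(** The discarded words begin with [d], hence with [d, 0], followed by an arbitrary word. *)
Lemma sum_words_minus (G : seq nat -> R) N :
  \sum_(x <- words_minus d N.+2) G x =
  \sum_(x <- words d N.+2) G x - \sum_(x <- words d N) G (d :: 0%N :: x).
Proof.
rewrite big_filter big_mkcond /= !sum_words_rec /= d_gt0 -addrA; congr (_ + _).
rewrite -sumrB; apply: eq_bigr => x _; case: d d_gt0 => // d' _.
rewrite !big_nat_recr //= ltnn addr0 addrK.
by rewrite big_nat [RHS]big_nat; apply: eq_bigr => j /= jd; rewrite ltnS jd.
Qed.

Lemma num_words_le N : F N <= F N.+1.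
Proof.
case: N => [|N]; first by rewrite num_words0 num_words1 lerDr.
by rewrite num_words_rec lerDl mulr_ge0.
Qed.

(** A proportion of at least [1 / (1 + d)] of the words survives, so bounds per word carry over at
    the cost of this factor. *)
Lemma size_words_minus_ge N :
  F N.+2 <= (1 + d%:R) * (size (words_minus d N.+2))%:R.
Proof.
have -> : (size (words_minus d N.+2))%:R = F N.+2 - F N.
  have := sum_words_minus (fun=> 1) N; rewrite !sum_words_cst !mul1r => <-.
  by rewrite big_const_seq count_predT iter_addr_0.
have d1 : 1 <= d%:R :> R by rewrite ler1n.
rewrite num_words_rec -subr_ge0 [leRHS](_ : _ =
  d%:R * (F N.+1 - F N) + (d%:R - 1) * (d%:R + 1) * F N); last by ring.
apply: addr_ge0; first by rewrite mulr_ge0 // subr_ge0 num_words_le.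
by rewrite mulr_ge0 // mulr_ge0 ?subr_ge0 // addr_ge0.
Qed.

Lemma words_minus_concentrated : concentrated (words_minus d).
Proof.
move=> f f0; have [phi phi0 H] := words_bounds f0.
exists (3 * (1 + d%:R) * phi); first by rewrite !mulr_ge0 ?addr_ge0.
move=> [|[|N]] // w W delta _ W0 delta0 wW wd Z B.
have [H0 H1 H2 H3] := H N.+2 w W delta W0 delta0 wW wd.
have {B} -> : B = 3 * (1 + d%:R) * (phi * (W + delta * N.+2%:R)).
  by rewrite /B mulrA.
move: H0 H1 H2 H3; set B := phi * _ => H0 H1 H2 H3.
have B0 : 0 <= B by rewrite mulr_ge0 // addr_ge0 // mulr_ge0.
have Fge := size_words_minus_ge N; set s := words_minus d N.+2.
have B3 : B <= 3 * (1 + d%:R) * B.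
  have : 0 <= d%:R * B by rewrite mulr_ge0.
  by lra.
split=> [x||].
- rewrite mem_filter => /andP[_ xw].
  have sx := size_words xw; move: xw; rewrite mem_words => /and3P[_ xd _].
  by apply: le_trans (H1 x _ xd) _; rewrite sx // ler_wpM2r.
(* [Z] is signed, so the restricted sum is handled as a difference of two full sums, the second
   shifted by the contribution of the prefix [d, 0]. *)
- rewrite sum_words_minus.
  rewrite [X in _ - X](eq_big_seq (fun x =>
    (w N.+2 * centered f d + w N.+1 * centered f 0%N) + Z x)); last first.
    by move=> x /size_words sx; rewrite /Z /= sx addrA.
  rewrite big_split /= sum_words_cst.
  apply: (@le_trans _ _ (3 * B * F N.+2)); last first.
    rewrite (_ : 3 * (1 + d%:R) * B * _ = 3 * B * ((1 + d%:R) * (size s)%:R)).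
      by rewrite ler_wpM2l // mulr_ge0.
    by ring.
  have FN0 : 0 <= F N by rewrite (le_trans _ (num_words_ge1 R d N)).
  have FN1 := num_words_le N.
  have F2 : B * (d%:R * F N) <= B * (F N.+2 - F N).
    by rewrite ler_wpM2l // num_words_rec; lra.
  have d1 : B * F N <= B * (d%:R * F N).
    by rewrite ler_wpM2l // ler_peMl // ler1n.
  have I2 := H2 N.+2 (leqnn _).
  have I0 := H2 N (leqW (leqnSn N)).
  have Ic : `|(w N.+2 * centered f d + w N.+1 * centered f 0%N) * F N|
      <= (B + B) * F N.
    rewrite normrM (ger0_norm FN0) ler_wpM2r //.
    by apply: le_trans (ler_normD _ _) _; apply: lerD; apply: H0 => //=.
  apply: le_trans (ler_normB _ _) _.
  apply: le_trans (lerD I2 (le_trans (ler_normD _ _) (lerD Ic I0))) _.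
  have BF0 : 0 <= B * F N by rewrite mulr_ge0.
  by move: d1 F2 BF0; lra.
(* Squares are nonnegative, so the sum may be enlarged to all words. *)
- rewrite big_filter.
  apply: (@le_trans _ _ (\sum_(x <- words d N.+2) Z x ^+ 2)).
    rewrite big_mkcond; apply: ler_sum => x _.
    by case: ifP => // _; apply: sqr_ge0.
  apply: le_trans H3 _.
  have P : 0 <= 3 * B ^+ 2 * N.+2%:R by rewrite mulr_ge0 // mulr_ge0 ?sqr_ge0.
  apply: le_trans (ler_wpM2l P Fge) _.
  rewrite -subr_ge0.
  rewrite [leRHS](_ : _ = 3 * B ^+ 2 * N.+2%:R * (size s)%:R *
     ((1 + d%:R) * (2 + 3 * d%:R))); last by ring.
  by rewrite (mulr_ge0 (mulr_ge0 P _)) // mulr_ge0 // addr_ge0 // mulr_ge0.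
Qed.

(** * Expansion of the size and its moments *)

Lemma sumn_weighted_sum (f : nat -> R) x :
  weighted_sum (centered f) (fun=> 1) x =
  \sum_(a <- x) f a - letter_mean f * (size x)%:R.
Proof.
elim: x => [|a x IH] /=; first by rewrite big_nil mulr0 subrr.
by rewrite IH big_cons /centered -addn1 natrD; ring.
Qed.

Lemma site_sum_weighted_sum x :
  weighted_sum (centered (fun a => a%:R)) (fun r => r%:R) x =
  (site_sum x)%:R
  - letter_mean (fun a => a%:R) * ((size x)%:R * ((size x)%:R + 1) / 2).
Proof.
elim: x => [|a x IH] /=; first by rewrite !mul0r mulr0 subrr.
by rewrite IH /centered natrD natrM -addn1 natrD; field.
Qed.

Lemma bin2_natr m : 'C(m, 2)%:R = m%:R * (m%:R - 1) / 2 :> R.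
Proof.
elim: m => [|m IH]; first by rewrite bin0n !mul0r.
by rewrite binS bin1 natrD IH -addn1 natrD; field.
Qed.

(** Each of the three statistics in the size formula is replaced by its mean plus a centred sum. The
    coefficient of [n^2] collects [al / 2] from positions, [ga] from binomials and [- al^2 / 2] from
    the number of parts. *)
Lemma core_size_expansion N x : size x = N ->
  let al := letter_mean (fun a => a%:R) in
  let ga := letter_mean (fun a => 'C(a, 2)%:R) in
  let s := weighted_sum (centered (fun a => a%:R)) (fun=> 1) x in
  let q := weighted_sum (centered (fun a => 'C(a, 2)%:R)) (fun=> 1) x in
  let t := weighted_sum (centered (fun a => a%:R)) (fun r => r%:R) x in
  (sumn (core_of N.+1 x))%:R - (al / 2 + ga - al ^+ 2 / 2) * N.+1%:R ^+ 2 =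
  t + N.+1%:R * q + (1 / 2 - al * N%:R - s / 2) * s
  + (al ^+ 2 * (2 * N%:R + 1) / 2 + al * N%:R / 2
     - (al / 2 + ga) * N.+1%:R).
Proof.
move=> sx al ga s q t.
have := @sumn_core_of N.+1 isT x; rewrite sx => /(_ (leqnn _)).
move=> /(congr1 (fun m => m%:R : R)); rewrite !natrD natrM bin2_natr.
have sumnE (h : nat -> nat) : (sumn [seq h a | a <- x])%:R
    = \sum_(a <- x) (h a)%:R :> R by rewrite sumnE big_map natr_sum.
have := site_sum_weighted_sum x; rewrite sx -/t -/al.
have := sumn_weighted_sum (fun a => a%:R) x; rewrite sx -/s -/al.
have := sumn_weighted_sum (fun a => 'C(a, 2)%:R) x; rewrite sx -/q -/ga.
rewrite -(sumnE id) map_id -sumnE -(addn1 N) natrD.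
move: (sumn x)%:R (site_sum x)%:R (sumn (map _ _))%:R (sumn (core_of _ _))%:R.
move=> S T Q X.
move=> /eqP; rewrite eq_sym subr_eq => /eqP -> /eqP.
rewrite eq_sym subr_eq => /eqP -> /eqP; rewrite eq_sym subr_eq => /eqP -> E.
rewrite -[X](addrK ((s + al * N%:R) * (s + al * N%:R - 1) / 2)) E.
by field.
Qed.

Lemma moments_of_concentrated s k :
  (0 < k)%N -> concentrated s -> (forall N x, x \in s N -> size x = N) ->
  exists A K : R, forall N, (1 < N)%N ->
  `|\sum_(x <- s N) (sumn (core_of N.+1 x))%:R ^+ k
    - A * N.+1%:R ^+ (2 * k) * (size (s N))%:R|
  <= K * N.+1%:R ^+ (2 * k - 1) * (size (s N))%:R.
Proof.
move=> k0 sc ssize.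
have [C1 C10 H1] := sc (fun a => a%:R) erefl.
have [C2 C20 H2] := sc (fun a => 'C(a, 2)%:R) erefl.
pose al := letter_mean (fun a => a%:R).
pose ga := letter_mean (fun a => 'C(a, 2)%:R).
pose c := al / 2 + ga - al ^+ 2 / 2.
pose C := C1 + C2; pose H := 1 + `|al| + C; pose E := al ^+ 2 + `|al| + `|ga|.
have C0 : 0 <= C by rewrite addr_ge0.
have H0 : 0 <= H by rewrite addr_ge0 // addr_ge0.
have E0 : 0 <= E by rewrite addr_ge0 // addr_ge0 // sqr_ge0.
(* The first group serves the pointwise and mean bounds, the second the sum of squares: 4 comes from
   squaring a sum of four terms, and 5 is 4 from [tf] plus 1 from [qf]. *)
pose K := (3 * C + H * C + E) + 4 * (5 * C ^+ 2 + H ^+ 2 * C ^+ 2 + E ^+ 2).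
have K10 : 0 <= 3 * C + H * C + E.
  by rewrite addr_ge0 // addr_ge0 // mulr_ge0.
have K20 : 0 <= 4 * (5 * C ^+ 2 + H ^+ 2 * C ^+ 2 + E ^+ 2).
  by rewrite mulr_ge0 // addr_ge0 ?sqr_ge0 // addr_ge0 // mulr_ge0 ?sqr_ge0.
have K0 : 0 <= K by rewrite addr_ge0.
have [K' HK'] := @sum_expr_concentrated R (seq nat) c K k k0 K0.
exists (c ^+ k), K' => N N1.
set n : R := N.+1%:R; set r := s N; set Fr : R := (size r)%:R.
have n1 : 1 <= n by rewrite /n ler1n.
have n0 : 0 <= n by apply: le_trans n1.
have Nn : N%:R = n - 1 by rewrite /n -addn1 natrD addrK.
have Nlen : N%:R <= n by rewrite Nn gerBl.
have N0 : 0 <= N%:R :> R by [].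
have Fr0 : 0 <= Fr by rewrite /Fr.
pose sf := weighted_sum (centered (fun a => a%:R)) (fun=> 1).
pose qf := weighted_sum (centered (fun a => 'C(a, 2)%:R)) (fun=> 1).
pose tf := weighted_sum (centered (fun a => a%:R)) (fun r => r%:R).
have sqr_mono (a b : R) : 0 <= a -> a <= b -> a ^+ 2 <= b ^+ 2.
  by move=> a0 ab; rewrite ler_pXn2r ?nnegrE // (le_trans a0).
have weaken (G : seq nat -> R) B0 B1 : 0 <= B0 -> B0 <= B1 ->
    [/\ forall x, x \in r -> `|G x| <= B0 * N%:R,
        `|\sum_(x <- r) G x| <= B0 * Fr
      & \sum_(x <- r) G x ^+ 2 <= B0 ^+ 2 * N%:R * Fr] ->
    [/\ forall x, x \in r -> `|G x| <= B1 * n,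
        `|\sum_(x <- r) G x| <= B1 * Fr
      & \sum_(x <- r) G x ^+ 2 <= B1 ^+ 2 * n * Fr].
  move=> B00 B01 [G1 G2 G3]; split=> [x /G1 /le_trans-> //||].
  - by rewrite ler_pM.
  - by apply: le_trans G2 _; rewrite ler_wpM2r.
  - apply: le_trans G3 _; rewrite ler_wpM2r // ler_pM ?sqr_ge0 //.
    exact: sqr_mono.
have [s1 s2 s3] : [/\ forall x, x \in r -> `|sf x| <= C * n,
      `|\sum_(x <- r) sf x| <= C * Fr
    & \sum_(x <- r) sf x ^+ 2 <= C ^+ 2 * n * Fr].
  apply: (@weaken _ (C1 * (1 + 0 * N%:R))).
  - by rewrite mul0r addr0 mulr1.
  - by rewrite mul0r addr0 mulr1 lerDl.
  - apply: H1 => // [m _|m]; first by rewrite normr1.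
    by rewrite subrr normr0.
have [q1 q2 q3] : [/\ forall x, x \in r -> `|qf x| <= C * n,
      `|\sum_(x <- r) qf x| <= C * Fr
    & \sum_(x <- r) qf x ^+ 2 <= C ^+ 2 * n * Fr].
  apply: (@weaken _ (C2 * (1 + 0 * N%:R))).
  - by rewrite mul0r addr0 mulr1.
  - by rewrite mul0r addr0 mulr1 lerDr.
  - apply: H2 => // [m _|m]; first by rewrite normr1.
    by rewrite subrr normr0.
have [t1 t2 t3] : [/\ forall x, x \in r -> `|tf x| <= (2 * C * n) * n,
      `|\sum_(x <- r) tf x| <= (2 * C * n) * Fr
    & \sum_(x <- r) tf x ^+ 2 <= (2 * C * n) ^+ 2 * n * Fr].
  apply: (@weaken _ (C1 * (N%:R + 1 * N%:R))).
  - by rewrite mulr_ge0 // addr_ge0 // mulr_ge0.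
  - rewrite mul1r (_ : 2 * C * n = C * (n + n)); last by ring.
    by rewrite ler_pM ?addr_ge0 // ?lerDl // lerD.
  - apply: H1 => // [m /andP[_ mN]|m]; first by rewrite normr_nat ler_nat.
    by rewrite -addn1 natrD addrAC subrr add0r normr1.
(* The quadratic term in [sf] is absorbed into the factor [u], which is [O(n)]. *)
pose u x := 1 / 2 - al * N%:R - sf x / 2.
pose e := al ^+ 2 * (2 * N%:R + 1) / 2 + al * N%:R / 2 - (al / 2 + ga) * n.
have YE x : x \in r -> (sumn (core_of N.+1 x))%:R - c * n ^+ 2 =
    tf x + n * qf x + u x * sf x + e.
  by move=> /ssize /core_size_expansion.
have alN : `|al * N%:R| <= `|al| * n.
  by rewrite normrM normr_nat ler_wpM2l.
have u1 x : x \in r -> `|u x| <= H * n.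
  move=> /s1 sx; apply: le_trans (ler_normB _ _) _.
  apply: le_trans (lerD (ler_normB _ _) (lexx _)) _.
  rewrite [`|1 / 2|]ger0_norm ?divr_ge0 // [`|sf x / 2|]normrM.
  rewrite [`|2^-1|]ger0_norm ?invr_ge0 //.
  have Cn0 : 0 <= C * n by rewrite mulr_ge0.
  by rewrite /H; lra.
have e1 : `|e| <= E * n.
  have -> : e = al ^+ 2 * (n - 1 / 2) - al / 2 - ga * n.
    by rewrite /e Nn; field.
  apply: le_trans (ler_normB _ _) _.
  apply: le_trans (lerD (ler_normB _ _) (lexx _)) _.
  rewrite normrM [`|al / 2|]normrM [`|ga * n|]normrM.
  rewrite [`|2^-1|]ger0_norm ?invr_ge0 // [`|al ^+ 2|]ger0_norm ?sqr_ge0 //.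
  rewrite [`|n|]ger0_norm // [`|n - _|]ger0_norm; last by lra.
  have A1 : `|al| <= `|al| * n by rewrite ler_peMr.
  have A2 := sqr_ge0 al; have A3 := normr_ge0 al.
  by rewrite /E; lra.
clearbody e.
have nn : n <= n ^+ 2 by rewrite expr2 ler_peMr.
have cst (a : R) : \sum_(x <- r) a = a * Fr.
  by rewrite big_const_seq count_predT iter_addr_0 mulr_natr.
have Kle (a : R) : 0 <= a -> (3 * C + H * C + E) * a <= K * a.
  by move=> a0; rewrite ler_wpM2r // lerDl.
apply: HK' => // [x xr||].
- rewrite YE //; apply: le_trans (Kle _ (sqr_ge0 n)).
  have b1 := t1 x xr.
  have b2 : `|n * qf x| <= C * n ^+ 2.
    rewrite normrM (ger0_norm n0) (_ : C * _ = n * (C * n)); last by ring.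
    by rewrite ler_wpM2l // q1.
  have b3 : `|u x * sf x| <= H * C * n ^+ 2.
    rewrite normrM (_ : H * C * _ = (H * n) * (C * n)); last by ring.
    by rewrite ler_pM // ?u1 ?s1.
  have b4 : E * n <= E * n ^+ 2 by rewrite ler_wpM2l.
  apply: le_trans (ler_normD _ _) _.
  apply: le_trans (lerD (ler_normD _ _) (lexx _)) _.
  apply: le_trans (lerD (lerD (ler_normD _ _) (lexx _)) (lexx _)) _.
  by move: b1 b2 b3 b4 e1; lra.
- rewrite (eq_big_seq _ YE) !big_split /= cst -mulr_sumr.
  (* A pointwise bound on [u * sf] would give only [O(n^2)]; the linear part has small mean, and the
     quadratic part uses the second moment of [sf]. *)
  have -> : \sum_(x <- r) u x * sf x =
      (1 / 2 - al * N%:R) * \sum_(x <- r) sf x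
      - 1 / 2 * \sum_(x <- r) sf x ^+ 2.
    rewrite !mulr_sumr -sumrB; apply: eq_bigr => x _; rewrite /u; ring.
  have nF0 : 0 <= n * Fr by rewrite mulr_ge0.
  rewrite -(mulrA K); apply: le_trans (Kle _ nF0).
  have b2 : `|n * \sum_(x <- r) qf x| <= n * (C * Fr).
    by rewrite normrM (ger0_norm n0) ler_wpM2l.
  have b3 : `|(1 / 2 - al * N%:R) * \sum_(x <- r) sf x|
      <= (1 + `|al|) * n * (C * Fr).
    rewrite normrM ler_pM //; apply: le_trans (ler_normB _ _) _.
    by rewrite [`|1 / 2|]ger0_norm //; move: alN; lra.
  have b4 : `|1 / 2 * \sum_(x <- r) sf x ^+ 2| <= C ^+ 2 * n * Fr.
    have S0 : 0 <= \sum_(x <- r) sf x ^+ 2.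
      by apply: sumr_ge0 => x _; apply: sqr_ge0.
    by rewrite ger0_norm ?mulr_ge0 //; move: s3 S0; lra.
  have b5 : `|e * Fr| <= E * n * Fr.
    by rewrite normrM (ger0_norm Fr0) ler_wpM2r.
  apply: le_trans (ler_normD _ _) _.
  apply: le_trans (lerD (ler_normD _ _) (lexx _)) _.
  apply: le_trans (lerD (lerD (ler_normD _ _) (ler_normB _ _)) (lexx _)) _.
  by move: t2 b2 b3 b4 b5; rewrite /H; lra.
- have Y2 x : x \in r -> ((sumn (core_of N.+1 x))%:R - c * n ^+ 2) ^+ 2 <=
    4 * (tf x ^+ 2 + n ^+ 2 * qf x ^+ 2 + (H * n) ^+ 2 * sf x ^+ 2 + e ^+ 2).
    move=> xr; rewrite YE //.
    have U : (u x * sf x) ^+ 2 <= (H * n) ^+ 2 * sf x ^+ 2.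
      rewrite exprMn ler_wpM2r ?sqr_ge0 // -real_normK ?num_real //.
      by apply: sqr_mono => //; apply: u1.
    apply: (@le_trans _ _ (4 * (tf x ^+ 2 + (n * qf x) ^+ 2
                                + (u x * sf x) ^+ 2 + e ^+ 2))).
      move: (tf x) (n * qf x) (u x * sf x) (e) => a b c' e'.
      (* Four times the sum of squares minus the square of the sum is the sum of squared pairwise
         differences. *)
      rewrite -subr_ge0 [leRHS](_ : _ = (a - b) ^+ 2 + (a - c') ^+ 2
        + (a - e') ^+ 2 + (b - c') ^+ 2 + (b - e') ^+ 2 + (c' - e') ^+ 2);
        last by ring.
      by rewrite !addr_ge0 ?sqr_ge0.
    by rewrite [(n * qf x) ^+ 2]exprMn; move: U; lra.
  have S2 : \sum_(x <- r) ((sumn (core_of N.+1 x))%:R - c * n ^+ 2) ^+ 2 <=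
      4 * (\sum_(x <- r) tf x ^+ 2 + n ^+ 2 * \sum_(x <- r) qf x ^+ 2
           + (H * n) ^+ 2 * \sum_(x <- r) sf x ^+ 2 + e ^+ 2 * Fr).
    rewrite -cst !mulr_sumr -!big_split /= mulr_sumr.
    by rewrite big_seq [leRHS]big_seq; apply: ler_sum.
  apply: le_trans S2 _.
  have c1 : n ^+ 2 * \sum_(x <- r) qf x ^+ 2 <= n ^+ 2 * (C ^+ 2 * n * Fr).
    by rewrite ler_wpM2l // sqr_ge0.
  have c2 : (H * n) ^+ 2 * \sum_(x <- r) sf x ^+ 2
      <= (H * n) ^+ 2 * (C ^+ 2 * n * Fr).
    by rewrite ler_wpM2l // sqr_ge0.
  have c3 : e ^+ 2 * Fr <= E ^+ 2 * (n ^+ 3 * Fr).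
    rewrite mulrA ler_wpM2r //; apply: (@le_trans _ _ ((E * n) ^+ 2)).
      by rewrite -real_normK ?num_real //; apply: sqr_mono.
    by rewrite exprMn ler_wpM2l ?sqr_ge0 // ler_weXn2l.
  apply: (@le_trans _ _ (4 * (5 * C ^+ 2 + H ^+ 2 * C ^+ 2 + E ^+ 2)
                         * (n ^+ 3 * Fr))).
    by move: t3 c1 c2 c3; rewrite !exprMn; lra.
  by rewrite -(mulrA K) ler_wpM2r ?mulr_ge0 ?exprn_ge0 // lerDr.
Qed.

End Concentration.

(** * From sums over words to expectations *)

Local Open Scope classical_set_scope.
Local Open Scope ring_scope.

Lemma uniform_expectation_seq (R : realType) (T : choiceType) (L : seq T)
    (f : T -> R) : uniq L ->
  uniform_expectation [set` L] f = (\sum_(x <- L) f x) / (size L)%:R.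
Proof.
move=> uL; rewrite /uniform_expectation -fsbig_seq //; congr (_ / _%:R).
apply/perm_size/uniq_perm => //.
by move=> x; rewrite in_fset_set //; apply/idP/idP; rewrite inE.
Qed.

Lemma core_size_moment_asymptotics (R : realType) (d k : nat) (t : nat -> nat)
    (s : nat -> seq (seq nat)) : (0 < d)%N -> (0 < k)%N ->
  @concentrated R d s ->
  (forall N, uniq (s N)) -> (forall N x, x \in s N -> size x = N) ->
  (forall N, (1 < N)%N -> (0 < size (s N))%N) ->
  (forall n, (2 < n)%N ->
    distinct_cores n (t n) = [set` [seq core_of n x | x <- s n.-1]]) ->
  exists A : R,
    (fun n : nat => core_size_moment R n (t n) k)
      = (fun n : nat => A * n%:R ^+ (2 * k)%N)
        +O_\oo (fun n : nat => n%:R ^+ (2 * k - 1)%N : R).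
Proof.
move=> d0 k0 sc us ss sp st.
have [A [K HK]] := moments_of_concentrated k0 sc ss.
(* The constant of the O-term is any [K'] beyond [K]; [n > 2] makes the word length [n - 1] exceed
   1. *)
exists A; apply/eqaddOP; near=> K'; near=> n.
have n2 : (2 < n)%N by near: n; apply: nbhs_infty_gt.
have nE : n = n.-1.+1 by rewrite prednK // (leq_trans _ n2).
have N1 : (1 < n.-1)%N by rewrite -ltnS -nE.
have S0 : 0 < (size (s n.-1))%:R :> R by rewrite ltr0n sp.
have ucore : uniq [seq core_of n x | x <- s n.-1].
  rewrite map_inj_in_uniq // => x y xs ys; apply: core_of_inj.
  - by rewrite nE.
  - exact: ss xs.
  - exact: ss ys.
have := HK _ N1; rewrite -nE => {}HK.
rewrite -[X in `|X| <= _]/(core_size_moment R n (t n) k - A * n%:R ^+ (2 * k)).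
rewrite /core_size_moment st // uniform_expectation_seq //.
rewrite big_map size_map [X in _ <= _ * X]ger0_norm ?exprn_ge0 //.
rewrite -(ler_pM2r S0).
apply: (@le_trans _ _ (K * n%:R ^+ (2 * k - 1) * (size (s n.-1))%:R)); last first.
  by rewrite !ler_wpM2r ?exprn_ge0 ?(ltW S0) //.
apply: le_trans HK; rewrite -[X in _ * X <= _]ger0_norm ?(ltW S0) // -normrM.
by rewrite -[X in X <= _]/(`|(_ / _ - _) * _|) mulrBl divfK // gt_eqF.
Unshelve. all: by end_near. Qed.

Unset Implicit Arguments.

Theorem theorem1p7 (R : realType) (d k : nat) (hd : (0 < d)%N) (hk : (0 < k)%N) :
  exists A B : R,
    (fun n : nat => core_size_moment R n (d * n + 1)%N k)
      = (fun n : nat => A * n%:R ^+ (2 * k)%N)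
        +O_\oo (fun n : nat => n%:R ^+ (2 * k - 1)%N : R)
    /\
    (fun n : nat => core_size_moment R n (d * n - 1)%N k)
      = (fun n : nat => B * n%:R ^+ (2 * k)%N)
        +O_\oo (fun n : nat => n%:R ^+ (2 * k - 1)%N : R).
Proof.
have [|N|N x|N _|n n2|A HA] := @core_size_moment_asymptotics R d k
    (fun n => d * n + 1)%N (words d) hd hk.
- exact: words_concentrated.
- exact: uniq_words.
- exact: size_words.
- by rewrite -(ltr0n R) (lt_le_trans _ (num_words_ge1 R d N)).
- by apply: distinct_cores_plus; apply: ltnW.
have [|N|N x|N|n n2|B HB] := @core_size_moment_asymptotics R d k
    (fun n => d * n - 1)%N (words_minus d) hd hk.
- exact: words_minus_concentrated.
- exact/filter_uniq/uniq_words.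
- by rewrite mem_filter => /andP[_ /size_words].
(* An empty family would force the number of all words, which is at least 1, to be at most 0. *)
- case: N => [|[|N]] // _; have := size_words_minus_ge R hd N.
  rewrite lt0n; case: (size _) => // /(le_trans (num_words_ge1 R d N.+2)).
  by rewrite mulr0 ler10.
- by apply: distinct_cores_minus => //; apply: ltnW.
by exists A, B.
Qed.
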